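(* Let $t$ be a positive integer. If there exists a Hadamard matrix of order $8t+4$, then there exists a basic $\mathsf{OA}_{2t+1}(4t+1,2)$.
   Context: For integers $k\ge 2$, $n\ge 2$, $\lambda\ge 1$, an orthogonal array $\mathsf{OA}_{\lambda}(k,n)$ is a $\lambda n^2$ by $k$ array with entries from a set $X$ of cardinality $n$ such that, within any two distinct columns, every ordered pair of symbols from $X$ occurs in exactly $\lambda$ rows (rows may be repeated). An $\mathsf{OA}_{\lambda}(k,n)$ is optimal if it contains a row that is repeated exactly $m=\frac{\lambda n^2}{k(n-1)+1}$ times (in particular this number is a positive integer). It is basic if it is optimal and $\gcd(m,\lambda)=1$ for this value of $m$. A Hadamard matrix of order $N$ is an $N\times N$ matrix $H$ with entries $\pm 1$ satisfying $HH^{T}=N I$. *)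

(* Defs.v *)
From HB Require Import structures.
From mathcomp Require Import all_boot all_order all_algebra.

Set Implicit Arguments.
Unset Strict Implicit.
Unset Printing Implicit Defensive.

Import GRing.Theory.

Definition is_Hadamard (N : nat) (H : 'M[int]_N) : Prop :=
  (forall i j : 'I_N, H i j = 1%R \/ H i j = (-1)%R) /\
  (H *m H^T = (N%:R)%:M)%R.

Definition is_OA (lambda k n : nat) (X : finType)
    (A : 'M[X]_(lambda * n ^ 2, k)) : Prop :=
  [/\ 2 <= k, 2 <= n, 1 <= lambda, #|X| = n &
      forall (j1 j2 : 'I_k), j1 != j2 -> forall (x y : X),
        #|[set i : 'I_(lambda * n ^ 2) | (A i j1 == x) && (A i j2 == y)]|
          = lambda].

Arguments is_OA lambda k n {X} A.

Definition row_mult (r k : nat) (X : finType) (A : 'M[X]_(r, k)) (i : 'I_r)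
    : nat :=
  #|[set i' : 'I_r | row i' A == row i A]|.

(* Truncated quotient: every use below also asks that the division be exact. *)
Definition optimal_mult (lambda k n : nat) : nat :=
  (lambda * n ^ 2) %/ (k * (n - 1) + 1).

Definition is_optimal_OA (lambda k n : nat) (X : finType)
    (A : 'M[X]_(lambda * n ^ 2, k)) : Prop :=
  [/\ is_OA lambda k n A,
      k * (n - 1) + 1 %| lambda * n ^ 2 &
      exists i : 'I_(lambda * n ^ 2), row_mult A i = optimal_mult lambda k n].

Arguments is_optimal_OA lambda k n {X} A.

Definition is_basic_OA (lambda k n : nat) (X : finType)
    (A : 'M[X]_(lambda * n ^ 2, k)) : Prop :=
  is_optimal_OA lambda k n A /\ gcdn (optimal_mult lambda k n) lambda = 1.

Arguments is_basic_OA lambda k n {X} A.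

(* Main.v *)
Require Import Defs.
From mathcomp Require Import all_boot all_order all_algebra.
From mathcomp Require Import zify.

(** Two distinct rows [r], [s] of a Hadamard matrix of order [4 * lambda] agree
    on a set [S] of exactly half of the columns, by orthogonality.  Fix a
    column [c0] in [S], change the signs of whole rows so that column [c0]
    becomes constant, and keep only the [2 * lambda - 1] other columns of [S].

    The columns of a Hadamard matrix are also pairwise orthogonal
    ([scalar_mulmxC]), so any two of the columns kept are orthogonal to each
    other and to the constant column; for vectors of signs this says that every
    pair of signs occurs equally often ([normalized_columns_balanced]).  The
    result is therefore an orthogonal array with 2 symbols and index [lambda].

    Rows [r] and [s] have become equal.  No third row [i] becomes equal to
    them: up to a global sign, [i] would agree with [r] and [s] on [S], while
    [r + s] vanishes outside [S], so the inner product of row [i] with [r + s]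
    would be [2 * #|S|] up to sign, whereas it is 0 ([third_row_differs]).  So a
    row is repeated exactly twice, which is the optimal multiplicity
    [4 * lambda / (2 * lambda)], and the array is basic because
    [lambda = 2 * t + 1] is odd. *)

Set Implicit Arguments.
Unset Strict Implicit.
Unset Printing Implicit Defensive.

Import GRing.Theory Num.Theory.
Local Open Scope ring_scope.

(** Over a domain the inverse of [B] need not exist, but [B] is still
    cancellable, by the adjugate, as soon as its determinant is nonzero. *)
Lemma scalar_mulmxC (R : idomainType) (n : nat) (A B : 'M[R]_n) (a : R) :
  a != 0 -> A *m B = a%:M -> B *m A = a%:M.
Proof.
move=> a0 AB; apply/eqP; rewrite -subr_eq0.
have detB0 : \det B != 0.
  have: \det A * \det B != 0 by rewrite -det_mulmx AB det_scalar expf_neq0.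
  by rewrite mulf_eq0 negb_or => /andP[].
have DB : (B *m A - a%:M) *m B = 0.
  by rewrite mulmxBl -mulmxA AB scalar_mxC subrr.
have : (B *m A - a%:M) *m B *m \adj B == 0 by rewrite DB mul0mx.
by rewrite -mulmxA mul_mx_adj mul_mx_scalar scalemx_eq0 (negPf detB0).
Qed.

Lemma Hadamard_entry_sqr (N : nat) (H : 'M[int]_N) (i j : 'I_N) :
  is_Hadamard H -> H i j * H i j = 1.
Proof. by case=> Hpm _; case: (Hpm i j) => ->. Qed.

Lemma Hadamard_rows_orthogonal (N : nat) (H : 'M[int]_N) (r s : 'I_N) :
  is_Hadamard H -> r != s -> \sum_j H r j * H s j = 0.
Proof.
case=> _ /matrixP/(_ r s); rewrite !mxE => HH /negPf rs.
by rewrite rs mulr0n in HH; rewrite -[RHS]HH; apply: eq_bigr => j _; rewrite mxE.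
Qed.

Lemma Hadamard_columns_orthogonal (N : nat) (H : 'M[int]_N) (c d : 'I_N) :
  is_Hadamard H -> c != d -> \sum_i H i c * H i d = 0.
Proof.
case=> _ HHT /negPf cd.
have N0 : N%:R != 0 :> int by have := ltn_ord c; rewrite pnatr_eq0; lia.
have /matrixP/(_ c d) := scalar_mulmxC N0 HHT.
rewrite !mxE cd mulr0n => HTH; rewrite -[RHS]HTH.
by apply: eq_bigr => i _; rewrite mxE.
Qed.

Definition agreement (N : nat) (H : 'M[int]_N) (r s : 'I_N) : {set 'I_N} :=
  [set j | H r j == H s j].

Lemma card_agreement (N : nat) (H : 'M[int]_N) (r s : 'I_N) :
  is_Hadamard H -> r != s -> (2 * #|agreement H r s| = N)%N.
Proof.
move=> hH rs; have := Hadamard_rows_orthogonal hH rs.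
have -> : \sum_j H r j * H s j = \sum_j (2%:R * (j \in agreement H r s)%:R - 1).
  apply: eq_bigr => j _; rewrite inE.
  by case: hH => Hpm _; case: (Hpm r j) => ->; case: (Hpm s j) => ->.
rewrite sumrB -mulr_sumr -natr_sum -big_mkcond /= sum1_card sumr_const card_ord.
by move/eqP; rewrite subr_eq0 -natrM eqr_nat => /eqP.
Qed.

(** Multiplying row [i] by the sign [H i c0] makes column [c0] constant, and
    [H i c0 * H i c == 1] is the sign found in column [c] afterwards.  With
    [a] and [b] the signs in columns [c] and [d], and [e x], [e y] those
    encoded by [x] and [y], four times the indicator of [a = e x, b = e y] is
    [(1 + e x * a) * (1 + e y * b)].  Summed over the rows, the terms of the
    expansion other than 1 are inner products of distinct columns. *)
Lemma normalized_columns_balanced (N : nat) (H : 'M[int]_N) (c0 c d : 'I_N)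
    (x y : bool) :
  is_Hadamard H -> c0 != c -> c0 != d -> c != d ->
  (4 * #|[set i | ((H i c0 * H i c == 1)%R == x)
               && ((H i c0 * H i d == 1)%R == y)]| = N)%N.
Proof.
move=> hH c0c c0d cd.
pose e (b : bool) : int := if b then 1 else -1.
set S := [set i | _].
have: \sum_i 4%:R * (i \in S)%:R = N%:R :> int.
  have -> : \sum_i 4%:R * (i \in S)%:R
      = \sum_(i < N) (1 + e x * (H i c0 * H i c) + e y * (H i c0 * H i d)
                      + e x * e y * (H i c * H i d)).
    apply: eq_bigr => i _; rewrite inE {S} /e; case: hH => Hpm _.
    by case: (Hpm i c0) => ->; case: (Hpm i c) => ->; case: (Hpm i d) => ->;
       case: x; case: y.
  rewrite !big_split /= -!mulr_sumr !Hadamard_columns_orthogonal //.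
  by rewrite !mulr0 !addr0 sumr_const card_ord.
rewrite -mulr_sumr -natr_sum -big_mkcond /= sum1_card -natrM.
by move/eqP; rewrite eqr_nat => /eqP.
Qed.

(** Otherwise row [i], up to sign, agrees with [r] and [s] wherever these two
    agree, hence has a nonzero inner product with [r + s]. *)
Lemma third_row_differs (N : nat) (H : 'M[int]_N) (r s i c0 : 'I_N) :
  is_Hadamard H -> r != s -> i != r -> i != s ->
  c0 \in agreement H r s ->
  exists2 c, c \in agreement H r s :\ c0
           & H i c0 * H i c != H r c0 * H r c.
Proof.
move=> hH rs ir is_ c0S; set S := agreement H r s in c0S *.
apply/exists_inP; apply: contraT; rewrite negb_exists_in => /forall_inP iS.
have iSall c : c \in S -> H i c0 * H i c = H r c0 * H r c.
  move=> cS; have [->|cc0] := eqVneq c c0; first by rewrite !Hadamard_entry_sqr.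
  by apply/eqP/negPn/iS; rewrite in_setD1 cc0.
(* [H r c0 * H i c0] is the sign by which row [i] differs from [r] on [S]. *)
have : \sum_c H r c0 * H i c0 * (H i c * H r c + H i c * H s c) = 0.
  by rewrite -mulr_sumr big_split /= !Hadamard_rows_orthogonal // addr0 mulr0.
have -> : \sum_c H r c0 * H i c0 * (H i c * H r c + H i c * H s c)
   = \sum_c 2%:R * (c \in S)%:R.
  apply: eq_bigr => c _; have [cS|] := boolP (c \in S).
    have := iSall c cS; move: cS; rewrite inE => /eqP <-.
    case: hH => Hpm _; case: (Hpm r c0) => ->; case: (Hpm i c0) => ->;
      by case: (Hpm r c) => ->; case: (Hpm i c) => ->.
  rewrite inE; case: hH => Hpm _.
  by case: (Hpm r c) => ->; case: (Hpm s c) => -> // _;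
    rewrite ?mulrN1 ?mulr1 ?addNr ?subrr !mulr0.
rewrite -mulr_sumr -natr_sum -big_mkcond /= sum1_card -natrM.
rewrite card_agreement // => /eqP; rewrite pnatr_eq0 => /eqP N0.
by have := ltn_ord i; rewrite {2}N0.
Qed.

(** The half [S] of the columns on which the first two rows agree supplies,
    once its reference column [c0] is removed, the columns of the array. *)
Lemma optimal_OA_of_Hadamard (lambda k : nat) (H : 'M[int]_(lambda * 2 ^ 2)) :
  (1 < lambda)%N -> k.+1 = (2 * lambda)%N -> is_Hadamard H ->
  exists A : 'M[bool]_(lambda * 2 ^ 2, k), is_optimal_OA lambda k 2 A.
Proof.
move=> l1 kE hH.
have r_lt : (0 < lambda * 2 ^ 2)%N by lia.
have s_lt : (1 < lambda * 2 ^ 2)%N by lia.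
pose r := Ordinal r_lt; pose s := Ordinal s_lt.
have rs : r != s by [].
pose S := agreement H r s.
have cardS : #|S| = k.+1 by have := card_agreement hH rs; rewrite -/S; lia.
have [c0 c0S] : exists c0, c0 \in S by apply/card_gt0P; rewrite cardS.
have cardS' : #|S :\ c0| = k by move: cardS; rewrite (cardsD1 c0) c0S; case.
pose f (j : 'I_k) := enum_val (cast_ord (esym cardS') j).
have f_inj : injective f by move=> j j' /enum_val_inj/cast_ord_inj.
have fS j : f j \in S :\ c0 by apply: enum_valP.
have c0f j : c0 != f j by have := fS j; rewrite !inE eq_sym => /andP[].
pose A : 'M[bool]_(lambda * 2 ^ 2, k) := \matrix_(i, j) (H i c0 * H i (f j) == 1).
have multE : optimal_mult lambda k 2 = 2%N.
  rewrite /optimal_mult (_ : lambda * 2 ^ 2 = 2 * (k * (2 - 1) + 1))%N; last lia.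
  by rewrite mulnK //; lia.
exists A; split.
- split=> //; [lia|lia|exact: card_bool|] => j1 j2 j12 x y.
  have j12' : f j1 != f j2 by rewrite (inj_eq f_inj).
  have := normalized_columns_balanced x y hH (c0f j1) (c0f j2) j12'.
  set B := finset _; set C := finset _; suff -> : C = B by lia.
  by apply/setP => i; rewrite !inE !mxE.
- by apply/dvdnP; exists 2%N; lia.
exists r; rewrite multE /row_mult (_ : [set _ | _] = [set r; s]) ?cards2 ?rs //.
apply/setP => i; rewrite !inE.
have [->|ir] := eqVneq i r; first by rewrite eqxx.
have [->|is_] := eqVneq i s.
  apply/eqP/rowP => j; rewrite !mxE.
  by move: c0S (fS j); rewrite !inE => /eqP -> /andP[_ /eqP ->].
apply/negbTE/eqP => /rowP eqA.
have [c cS'] := third_row_differs hH rs ir is_ c0S.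
have [j ->] : exists j, c = f j.
  exists (cast_ord cardS' (enum_rank_in cS' c)).
  by rewrite /f cast_ordK enum_rankK_in.
have := eqA j; rewrite !mxE; case: hH => Hpm _.
by case: (Hpm i c0) => ->; case: (Hpm r c0) => ->;
   case: (Hpm i (f j)) => ->; case: (Hpm r (f j)) => ->.
Qed.

Local Close Scope ring_scope.

Theorem theorem3p3 (t : nat) (ht : 0 < t)
    (hH : exists H : 'M[int]_(8 * t + 4), is_Hadamard H) :
  exists (X : finType) (A : 'M[X]_((2 * t + 1) * 2 ^ 2, 4 * t + 1)),
    is_basic_OA (2 * t + 1) (4 * t + 1) 2 A.
Proof.
have orderE : 8 * t + 4 = (2 * t + 1) * 2 ^ 2 by lia.
rewrite orderE in hH; case: hH => H hH.
have [||A optA] := @optimal_OA_of_Hadamard (2 * t + 1) (4 * t + 1) H _ _ hH.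
- lia.
- lia.
exists bool, A; split=> //.
have -> : optimal_mult (2 * t + 1) (4 * t + 1) 2 = 2.
  rewrite /optimal_mult.
  have -> : (2 * t + 1) * 2 ^ 2 = 2 * ((4 * t + 1) * (2 - 1) + 1) by lia.
  by rewrite mulnK //; lia.
by apply/eqP; rewrite -/(coprime _ _) coprime2n; lia.
Qed.
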